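(* There is a unique stationary probability measure $\nu_{\mathrm{s}}$ on $\mathbf{\Gamma}_{\bullet}$ for simple random walk. Furthermore, $\nu_{\mathrm{s}}$ is continuous, that is, every singleton has measure $0$.
   Context: $\mathbb{Z}_2$ denotes the dyadic ($2$-adic) integers, identified with left-infinite binary strings $a=(a_k)_{k\le 0}=\sum_{k\le 0}a_k2^{-k}$, $a_k\in\{0,1\}$. Let $\mathbf{\Gamma}$ be the graph on $\mathbb{Z}\times\mathbb{Z}_2$ with edges between $(m,b)$ and $(m,b\pm1)$ and between $(m,b)$ and $(m+1,2b)$. $\Gamma_a$ is the connected component of $(0,a)$, rooted at $(0,a)$. The collection $\mathbf{\Gamma}_{\bullet}=\{\Gamma_a : a\in\mathbb{Z}_2\}$ is identified with $\mathbb{Z}_2$ via $\Gamma_a\leftrightarrow a$. Simple random walk on $\mathbf{\Gamma}_{\bullet}$ (moving the root to a uniformly random neighbour) is the Markov chain on $\mathbb{Z}_2$ which from $a$ moves to one of $a+1$, $a-1$, $2a$, and, if $a$ is even, also $a/2$, chosen uniformly among the three (if $a$ is odd) or four (if $a$ is even) options. A stationary probability measure for simple random walk on $\mathbf{\Gamma}_{\bullet}$ is a (Borel) probability measure on $\mathbb{Z}_2$ that is stationary for this chain. *)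

(* Defs.v *)
From HB Require Import structures.
From mathcomp Require Import all_boot all_order all_algebra.
From mathcomp Require Import zify ring.
From mathcomp Require Import all_classical all_reals all_analysis.
Set Implicit Arguments.
Unset Strict Implicit.
Unset Printing Implicit Defensive.
Import Order.TTheory GRing.Theory Num.Theory.
Local Open Scope classical_set_scope.

(* The dyadic integers. The digit called a_{-k} in the left-infinite string
   (a_k)_{k <= 0} is [a k] here, so that a = \sum_k (a k) 2^k. The topology
   is the product topology, which is the 2-adic one. *)
Definition Z2 : Type := cantor_space.

HB.instance Definition _ := Uniform.copy Z2 cantor_space.
HB.instance Definition _ := Pointed.copy Z2 cantor_space.

Implicit Types (a b c : Z2) (s : nat -> nat).

(* The ring operations are those of the inverse limit of the Z/2^n:
   [residue n a] is the representative of a mod 2^n in [0, 2^n), and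
   [of_residues s] is the dyadic integer congruent to [s n] mod 2^n for every n
   (see [residue_of_residues]). *)
Definition residue n a : nat := \sum_(k < n) a k * 2 ^ k.

Definition of_residues s : Z2 := fun k => odd (s k.+1 %/ 2 ^ k).

Definition compatible s := forall n, s n.+1 = s n %[mod 2 ^ n].

Lemma residueS n a : residue n.+1 a = residue n a + a n * 2 ^ n.
Proof. by rewrite /residue big_ord_recr. Qed.

Lemma residue_lt n a : residue n a < 2 ^ n.
Proof.
elim: n => [|n IHn]; first by rewrite /residue big_ord0.
rewrite residueS expnS; case: (a n); lia.
Qed.

Lemma residue_compatible a : compatible (residue^~ a).
Proof. by move=> n; rewrite residueS addnC modnMDl. Qed.

Lemma residue_of_residues s n :
  compatible s -> residue n (of_residues s) = s n %% 2 ^ n.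
Proof.
move=> sP; elim: n => [|n IHn]; first by rewrite /residue big_ord0 modn1.
rewrite residueS IHn -sP /of_residues.
have e2 : 0 < 2 ^ n by rewrite expn_gt0.
rewrite -modn2 expnS; set x := s n.+1 %/ _; set r := s n.+1 %% _.
have r_lt : r < 2 ^ n by rewrite ltn_mod.
have -> : s n.+1 = x %/ 2 * (2 * 2 ^ n) + (r + x %% 2 * 2 ^ n).
  rewrite addnCA mulnA -mulnDl -divn_eq addnC; exact: divn_eq.
rewrite modnMDl [RHS]modn_small //.
rewrite mul2n -addnn -addSn leq_add // -[leqRHS]mul1n.
by rewrite leq_mul2r -ltnS ltn_mod orbT.
Qed.

Lemma residue_inj a b : (forall n, residue n a = residue n b) -> a = b.
Proof.
move=> ab; apply/funext => n; have := ab n.+1.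
rewrite !residueS ab; have : 0 < 2 ^ n by rewrite expn_gt0.
by case: (a n); case: (b n) => //; lia.
Qed.

Definition Z2_zero : Z2 := of_residues (fun=> 0).
Definition Z2_one : Z2 := of_residues (fun=> 1).
Definition Z2_add a b : Z2 :=
  of_residues (fun n => residue n a + residue n b).
Definition Z2_opp a : Z2 := of_residues (fun n => 2 ^ n - residue n a).
Definition Z2_mul a b : Z2 :=
  of_residues (fun n => residue n a * residue n b).

Lemma residue_zero n : residue n Z2_zero = 0.
Proof. by rewrite residue_of_residues ?mod0n. Qed.

Lemma residue_one n : residue n Z2_one = 1 %% 2 ^ n.
Proof. by rewrite residue_of_residues. Qed.

Lemma residue_add n a b :
  residue n (Z2_add a b) = (residue n a + residue n b) %% 2 ^ n.
Proof.
rewrite residue_of_residues // => k.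
by rewrite -modnDm !residue_compatible modnDm.
Qed.

Lemma residue_mul n a b :
  residue n (Z2_mul a b) = (residue n a * residue n b) %% 2 ^ n.
Proof.
rewrite residue_of_residues // => k.
by rewrite -modnMm !residue_compatible modnMm.
Qed.

Lemma residue_opp n a :
  residue n (Z2_opp a) = (2 ^ n - residue n a) %% 2 ^ n.
Proof.
rewrite residue_of_residues // => k; apply/eqP.
rewrite -(eqn_modDr (residue k a)) subnK ?(ltnW (residue_lt _ _)) //.
rewrite -modnDmr -residue_compatible modnDmr subnK ?(ltnW (residue_lt _ _)) //.
by rewrite expnS modnMl modnn.
Qed.

Lemma Z2_addA : associative Z2_add.
Proof.
by move=> a b c; apply: residue_inj => n; rewrite !residue_add modnDml modnDmr addnA.
Qed.

Lemma Z2_addC : commutative Z2_add.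
Proof. by move=> a b; apply: residue_inj => n; rewrite !residue_add addnC. Qed.

Lemma Z2_add0 : left_id Z2_zero Z2_add.
Proof.
move=> a; apply: residue_inj => n.
by rewrite residue_add residue_zero add0n modn_small ?residue_lt.
Qed.

Lemma Z2_addN : left_inverse Z2_zero Z2_opp Z2_add.
Proof.
move=> a; apply: residue_inj => n.
rewrite residue_add residue_opp residue_zero modnDml subnK ?modnn //.
by rewrite ltnW ?residue_lt.
Qed.

Lemma Z2_mulA : associative Z2_mul.
Proof.
by move=> a b c; apply: residue_inj => n; rewrite !residue_mul modnMml modnMmr mulnA.
Qed.

Lemma Z2_mulC : commutative Z2_mul.
Proof. by move=> a b; apply: residue_inj => n; rewrite !residue_mul mulnC. Qed.

Lemma Z2_mul1 : left_id Z2_one Z2_mul.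
Proof.
move=> a; apply: residue_inj => n.
by rewrite residue_mul residue_one modnMml mul1n modn_small ?residue_lt.
Qed.

Lemma Z2_mulDl : left_distributive Z2_mul Z2_add.
Proof.
move=> a b c; apply: residue_inj => n.
by rewrite !(residue_mul, residue_add) modnMml modnDm mulnDl.
Qed.

Lemma Z2_one_neq0 : Z2_one != Z2_zero.
Proof.
by apply/eqP => /(congr1 (residue 1)); rewrite residue_one residue_zero.
Qed.

HB.instance Definition _ :=
  GRing.isZmodule.Build Z2 Z2_addA Z2_addC Z2_add0 Z2_addN.
HB.instance Definition _ := GRing.Zmodule_isComNzRing.Build Z2
  Z2_mulA Z2_mulC Z2_mul1 Z2_mulDl Z2_one_neq0.

(* The Borel sigma-algebra. *)
HB.instance Definition _ :=
  Measurable.copy Z2 (g_sigma_algebraType (@open Z2)).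

Local Open Scope ring_scope.

Definition Z2_even a : bool := ~~ a 0%N.

(* Junk unless [a] is even. *)
Definition Z2_half a : Z2 := fun k => a k.+1.

Lemma residue_double n b : residue n.+1 (2 * b) = (2 * residue n b)%N.
Proof.
rewrite (_ : 2 * b = b + b); last by rewrite -mulr2n mulr_natl.
rewrite [LHS]residue_add addnn -mul2n expnS -muln_modr residueS addnC modnMDl.
by rewrite modn_small ?residue_lt.
Qed.

Lemma Z2_double_even b : Z2_even (2 * b).
Proof.
have := residue_double 0 b.
rewrite /residue big_ord1 big_ord0 muln1 /Z2_even.
by case: ((2 * b : Z2) 0%N).
Qed.

Lemma Z2_halfK a : Z2_even a -> 2 * Z2_half a = a.
Proof.
rewrite /Z2_even => /negbTE a0; apply: residue_inj => -[|n].
  by rewrite /residue !big_ord0.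
rewrite residue_double /residue big_ord_recl a0 add0n big_distrr /=.
by apply: eq_bigr => i _; rewrite expnS mulnCA.
Qed.

Lemma Z2_doubleK b : Z2_half (2 * b) = b.
Proof.
have e := Z2_halfK (Z2_double_even b).
apply: residue_inj => n; apply/eqP; rewrite -(eqn_pmul2l (isT : 0 < 2)%N).
by rewrite -!residue_double e.
Qed.

(* The graph on Z x Z_2; [Gamma_arc] orients each edge in one direction. *)
Definition Gamma_arc (u v : int * Z2) : Prop :=
  v = (u.1, u.2 + 1) \/ v = (u.1 + 1, 2 * u.2).

Definition Gamma_adj (u v : int * Z2) : Prop := Gamma_arc u v \/ Gamma_arc v u.

Definition Gamma_nbrs (u : int * Z2) : seq (int * Z2) :=
  [:: (u.1, u.2 + 1), (u.1, u.2 - 1), (u.1 + 1, 2 * u.2) &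
     if Z2_even u.2 then [:: (u.1 - 1, Z2_half u.2)] else [::]].

Lemma mem_Gamma_nbrs u v : v \in Gamma_nbrs u <-> Gamma_adj u v.
Proof.
case: u v => [m a] [k b]; rewrite /Gamma_adj /Gamma_arc /Gamma_nbrs /=.
rewrite !inE; split.
- case/or4P => [/eqP-> | /eqP[-> ->] | /eqP-> |].
  + by left; left.
  + by right; left; rewrite subrK.
  + by left; right.
  + case: ifP => // ae; rewrite inE => /eqP[-> ->].
    by right; right; rewrite subrK Z2_halfK.
- case=> -[] [-> ->].
  + by rewrite eqxx.
  + by rewrite eqxx !orbT.
  + by rewrite addrK eqxx !orbT.
  + by rewrite Z2_double_even inE addrK Z2_doubleK eqxx !orbT.
Qed.

Lemma uniq_Gamma_nbrs u : uniq (Gamma_nbrs u).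
Proof.
case: u => [m a]; rewrite /Gamma_nbrs /=.
have m1 : (m == m + 1) = false by apply/eqP; lia.
have m2 : (m == m - 1) = false by apply/eqP; lia.
have m3 : (m + 1 == m - 1) = false by apply/eqP; lia.
have a1 : (a + 1 == a - 1) = false.
  apply/eqP => /addrI /(congr1 (+%R 1)); rewrite subrr => /(congr1 (residue 2)).
  by rewrite [residue _ 0]residue_zero residue_add residue_one.
by case: ifP; rewrite !inE /= !xpair_eqE !eqxx /= m1 ?m2 ?m3 a1.
Qed.

(* Moving the root of Gamma_a, i.e. (0, a), to the vertex (m, b) yields a rooted
   graph isomorphic to Gamma_b. This is a sequence, not a set: two neighbours
   may carry the same dyadic integer (e.g. 2 * 0 = 0 = 0 / 2) and then both
   count. *)
Definition walk_moves a : seq Z2 := [seq v.2 | v <- Gamma_nbrs (0, a)].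

Lemma walk_movesE a : walk_moves a =
  if Z2_even a then [:: a + 1; a - 1; 2 * a; Z2_half a]
  else [:: a + 1; a - 1; 2 * a].
Proof. by rewrite /walk_moves /=; case: ifP. Qed.

Local Open Scope ereal_scope.

(* [walk_step a A] is the probability that the walk moves from a into A;
   [\d_b A] is 1 if b is in A and 0 otherwise. *)
Definition walk_step (R : realType) a (A : set Z2) : \bar R :=
  ((size (walk_moves a))%:R^-1)%:E * \sum_(b <- walk_moves a) \d_b A.

Definition walk_stationary (R : realType) (nu : probability Z2 R) : Prop :=
  forall A : set Z2, measurable A -> \int[nu]_a walk_step R a A = nu A.

(* Main.v *)
Require Import Defs.
From HB Require Import structures.
From mathcomp Require Import all_boot all_order all_algebra.
From mathcomp Require Import zify ring lra.
From mathcomp Require Import all_classical all_reals all_analysis.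
From mathcomp Require Import measurable_realfun.
Set Implicit Arguments.
Unset Strict Implicit.
Unset Printing Implicit Defensive.
Import Order.TTheory GRing.Theory Num.Theory.
Import numFieldNormedType.Exports.
Local Open Scope classical_set_scope.
Local Open Scope ring_scope.

(* Let P be the transition operator, and let g depend on finitely many digits.
   Run two copies of the walk that agree modulo 2^n: while n > 0 they have the
   same parity and can make the same moves, and n increases at a doubling and
   decreases at a halving; from points of different parity, both copies double
   with probability at least 1/4. Hence n dominates a lazy reflected random walk
   on the naturals, whose probability of being below a fixed level tends to 0
   (null recurrence), so that P^t g converges uniformly to a constant. These
   constants are the integrals of g for every stationary probability measure,
   which gives uniqueness, and they are consistent cylinder masses, which gives
   existence.

   For continuity, nu{a} / deg(a) is harmonic for the walk. If it were not zero,
   then near a point where it almost reaches its supremum M it would be at least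
   M / 2 at a, a + 1, a + 2, ... for arbitrarily long, and the total mass would
   be infinite. *)

(** * Residues, digits and their behaviour under the moves *)

Lemma residue0 (a : Z2) : residue 0 a = 0%N.
Proof. by rewrite /residue big_ord0. Qed.

Lemma residueS_recl n (a : Z2) :
  residue n.+1 a = (a 0%N + 2 * residue n (Z2_half a))%N.
Proof.
rewrite /residue big_ord_recl expn0 muln1 big_distrr /=.
by congr addn; apply: eq_bigr => i _; rewrite expnS mulnCA.
Qed.

Lemma residueSW n (a b : Z2) :
  residue n.+1 a = residue n.+1 b -> residue n a = residue n b.
Proof.
move=> /(congr1 (modn^~ (2 ^ n)%N)); rewrite !residue_compatible.
by rewrite !modn_small ?residue_lt.
Qed.

Lemma residueW m n (a b : Z2) : (m <= n)%N ->
  residue n a = residue n b -> residue m a = residue m b.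
Proof.
move=> /subnKC <-; elim: (n - m)%N => [|k IHk]; first by rewrite addn0.
by rewrite addnS => /residueSW.
Qed.

Lemma eq_residueS n (a b : Z2) : residue n.+1 a = residue n.+1 b ->
  a 0%N = b 0%N /\ residue n (Z2_half a) = residue n (Z2_half b).
Proof.
rewrite !residueS_recl.
by case: (a 0%N); case: (b 0%N) => //= ?; split=> //; lia.
Qed.

Lemma eq_residue_digit n (a b : Z2) : residue n a = residue n b ->
  forall k, (k < n)%N -> a k = b k.
Proof.
by elim: n a b => // n IHn a b /eq_residueS [ab0 /IHn abS] [|k] // /abS.
Qed.

Lemma eq_digit_residue n (a b : Z2) : (forall k, (k < n)%N -> a k = b k) ->
  residue n a = residue n b.
Proof. by move=> ab; apply: eq_bigr => i _; rewrite ab. Qed.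

Lemma eq_residueD n (a b c : Z2) : residue n a = residue n b ->
  residue n (a + c) = residue n (b + c).
Proof. by move=> ab; rewrite ![LHS]residue_add ab [RHS]residue_add. Qed.

Lemma eq_residue_double n (a b : Z2) : residue n a = residue n b ->
  residue n.+1 (2 * a) = residue n.+1 (2 * b).
Proof. by rewrite !residue_double => ->. Qed.

(** * The transition operator and the comparison with a reflected walk on the naturals *)

Section walk_operator.
Variable R : realType.
Implicit Types (f g : Z2 -> R) (D : nat -> R) (a : Z2).

Definition walk_op g a : R :=
  (size (walk_moves a))%:R^-1 * \sum_(b <- walk_moves a) g b.

Lemma walk_op_even g a : Z2_even a ->
  walk_op g a = 4^-1 * (g (a + 1) + g (a - 1) + g (2 * a) + g (Z2_half a)).
Proof.
by move=> ae; rewrite /walk_op walk_movesE ae /= !big_cons big_nil addr0 !addrA.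
Qed.

Lemma walk_op_odd g a : ~~ Z2_even a ->
  walk_op g a = 3^-1 * (g (a + 1) + g (a - 1) + g (2 * a)).
Proof.
move=> /negbTE ao.
by rewrite /walk_op walk_movesE ao /= !big_cons big_nil addr0 !addrA.
Qed.

Lemma walk_op_le f g : (forall a, f a <= g a) ->
  forall a, walk_op f a <= walk_op g a.
Proof. by move=> fg a; rewrite ler_wpM2l ?invr_ge0 ?ler0n ?ler_sum. Qed.

Lemma walk_op_cst (c : R) a : walk_op (fun=> c) a = c.
Proof.
by have [ae|ae] := boolP (Z2_even a);
  [rewrite walk_op_even|rewrite walk_op_odd] => //; lra.
Qed.

Lemma walk_op_sum I (s : seq I) (c : I -> R) (F : I -> Z2 -> R) a :
  walk_op (fun b => \sum_(i <- s) c i * F i b) a =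
  \sum_(i <- s) c i * walk_op (F i) a.
Proof.
rewrite /walk_op exchange_big mulr_sumr /=; apply: eq_bigr => i _.
by rewrite -mulr_sumr mulrCA.
Qed.

(* The kernel of the lazy simple random walk on the naturals, reflected at 0. *)
Definition reflected_op D n : R :=
  if n is m.+1 then 2^-1 * D n + 4^-1 * (D m + D m.+2)
  else 3 / 4 * D 0%N + 4^-1 * D 1%N.

Definition modulus_le g D :=
  forall n a b, residue n a = residue n b -> g a - g b <= D n.

(* At odd points doubling is likelier and halving impossible, which can only
   decrease the bound because [D] is nonincreasing. *)
Lemma walk_op_modulus g D : {homo D : m n / (m <= n)%N >-> n <= m} ->
  modulus_le g D -> modulus_le (walk_op g) (reflected_op D).
Proof.
move=> Dm gD.
have D1 n : D n.+1 <= D n by apply: Dm.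
have step m a b : residue m.+1 a = residue m.+1 b ->
    walk_op g a - walk_op g b <= reflected_op D m.+1.
  move=> ab; have [ab0 abh] := eq_residueS ab.
  have eab : Z2_even a = Z2_even b by rewrite /Z2_even ab0.
  have := gD _ _ _ (eq_residueD 1 ab); have := gD _ _ _ (eq_residueD (- 1) ab).
  have := gD _ _ _ (eq_residue_double ab); have := gD _ _ _ abh.
  have := D1 m; have := D1 m.+1; rewrite /reflected_op.
  case: (boolP (Z2_even a)) => ae.
    by rewrite !walk_op_even -?eab //; lra.
  by rewrite !walk_op_odd -?eab //; lra.
case=> [|m] a b ab; last exact: step.
have g0 c d : g c - g d <= D 0%N by apply: gD; rewrite !residue0.
have g2 : g (2 * a) - g (2 * b) <= D 1%N.
  by apply: gD; apply: eq_residue_double; rewrite !residue0.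
have := D1 0%N; have := D1 1%N.
have [e|/eqP e] := eqVneq (Z2_even a) (Z2_even b).
  (* Equal parity means agreement modulo 2, so the bound at level 1 is available; monotonicity of
     [D] puts it below the bound at level 0. *)
  have /step : residue 1 a = residue 1 b.
    apply: eq_digit_residue => -[|//] _; move: e; rewrite /Z2_even.
    by case: (a 0%N); case: (b 0%N).
  rewrite /reflected_op; lra.
move: g2 e; rewrite /reflected_op.
(* Pair the doublings, and the shifts of equal sign, with weight 1/4 each. Every move of the odd
   point has 1/3 - 1/4 = 1/12 left, and these three remainders are paired with the halving of the
   even point. *)
case: (boolP (Z2_even a)) => ae; case: (boolP (Z2_even b)) => be // g2 _.
  rewrite walk_op_even ?walk_op_odd //.
  have := g0 (a + 1) (b + 1); have := g0 (a - 1) (b - 1).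
  have := g0 (Z2_half a) (b + 1); have := g0 (Z2_half a) (b - 1).
  have := g0 (Z2_half a) (2 * b); lra.
rewrite walk_op_odd ?walk_op_even //.
have := g0 (a + 1) (b + 1); have := g0 (a - 1) (b - 1).
have := g0 (a + 1) (Z2_half b); have := g0 (a - 1) (Z2_half b).
have := g0 (2 * a) (Z2_half b); lra.
Qed.

(* The probability that the reflected walk started at [n] is below [N]
   at time [t]. *)
Definition reflected_prob N t : nat -> R :=
  iter t reflected_op (fun n => (n < N)%:R).

(** Laziness makes the reflected walk stochastically monotone in its start; this is the monotonicity
    that [walk_op_modulus] asks of its bound. *)
Lemma reflected_prob_homo N t :
  {homo reflected_prob N t : m n / (m <= n)%N >-> n <= m}.
Proof.
apply: homo_leq => [x //|y x z xy yz|n]; first exact: le_trans yz xy.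
elim: t n => [|t IHt] n /=.
  by rewrite ler_nat; case: (ltnP n.+1 N) => // /ltnW ->.
case: n => [|n] /=.
  have := IHt 0%N; have := IHt 1%N; lra.
have := IHt n; have := IHt n.+1; have := IHt n.+2; lra.
Qed.

Lemma reflected_prob_ge0 N t n : 0 <= reflected_prob N t n.
Proof.
elim: t n => [|t IHt] [|n] /=; rewrite ?ler0n //.
  have := IHt 0%N; have := IHt 1%N; lra.
have := IHt n; have := IHt n.+1; have := IHt n.+2; lra.
Qed.

(** The kernel is symmetric, so counting measure is invariant and the total over all starts stays
    [N]. Truncation at [K] only adds a boundary flux, which is nonpositive by monotonicity. *)
Lemma reflected_prob_sum N t K :
  \sum_(n < K) reflected_prob N t n <= N%:R.
Proof.
elim: t => [|t IHt].
  rewrite /reflected_prob /= -natr_sum ler_nat.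
  suff : (\sum_(n < K) (n < N) <= minn K N)%N by rewrite leq_min => /andP[].
  elim: K => [|K IHK]; first by rewrite big_ord0.
  rewrite big_ord_recr /=; apply: leq_trans (leq_add IHK (leqnn _)) _.
  by case: (ltnP K N); lia.
apply: le_trans IHt.
case: K => [|K]; first by rewrite !big_ord0.
have u1 n : reflected_prob N t n.+1 <= reflected_prob N t n.
  exact: reflected_prob_homo.
(* One step adds a quarter of the discrete Laplacian, whose sum telescopes; reflection leaves no
   boundary term at 0. *)
suff -> : \sum_(n < K.+1) reflected_prob N t.+1 n =
   \sum_(n < K.+1) reflected_prob N t n
   + 4^-1 * (reflected_prob N t K.+1 - reflected_prob N t K).
  have := u1 K; lra.
elim: K => [|K IHK].
  by rewrite !big_ord_recr !big_ord0 /=; field.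
by rewrite big_ord_recr IHK [in RHS]big_ord_recr /=; field.
Qed.

(* The value at 0 decreases to some l, so that by the recursion l is the limit
   at every n; since the sum over n remains at most N, l = 0. *)
Lemma reflected_prob_cvg0 N : reflected_prob N ^~ 0%N @ \oo --> (0 : R).
Proof.
set u := reflected_prob N.
have uS t : u t.+1 0%N <= u t 0%N.
  by rewrite /u /=; have := @reflected_prob_homo N t 0%N 1%N isT; lra.
have /cvg_ex[l ul] : cvgn (u ^~ 0%N).
  apply: nonincreasing_is_cvgn.
    by apply/nonincreasing_seqP.
  by exists 0 => _ [t _ <-]; exact: reflected_prob_ge0.
have shift n : u ^~ n @ \oo --> l -> (fun t => u t.+1 n) @ \oo --> l.
  by move=> un; rewrite (cvg_shiftS (u ^~ n)).
have u1 : u ^~ 1%N @ \oo --> l.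
  have -> : u ^~ 1%N = fun t => 4 * u t.+1 0%N - 3 * u t 0%N.
    by apply/funext => t /=; rewrite /u /=; field.
  have -> : l = 4 * l - 3 * l by ring.
  by apply: cvgB; apply: cvgMr => //; exact: shift.
have uSS n : u ^~ n @ \oo --> l /\ u ^~ n.+1 @ \oo --> l.
  elim: n => [//|n [un un1]]; split=> //.
  have -> : u ^~ n.+2 = fun t => 4 * u t.+1 n.+1 - 2 * u t n.+1 - u t n.
    by apply/funext => t /=; rewrite /u /=; field.
  have -> : l = 4 * l - 2 * l - l by ring.
  apply: cvgB => //.
  by apply: cvgB; apply: cvgMr => //; exact: shift.
have sumK K : K%:R * l <= N%:R.
  have sK : (fun t => \sum_(n < K) u t n) @ \oo --> \sum_(n < K) l.
    apply: cvg_big => [|n _]; last by have [] := uSS n.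
    exact: add_continuous.
  rewrite mulr_natl -[X in _ *+ X]card_ord -sumr_const.
  rewrite -(cvg_lim _ sK) //.
  apply: limr_le; first exact: cvgP sK.
  by apply: nearW => t; exact: reflected_prob_sum.
suff -> : 0 = l by [].
apply/le_anti/andP; split.
  rewrite -(cvg_lim _ ul) //.
  apply: limr_ge; first exact: cvgP ul.
  by apply: nearW => t; exact: reflected_prob_ge0.
rewrite leNgt; apply/negP => l0.
have := sumK (Num.Def.truncn (N%:R / l)).+1; apply/negP; rewrite -ltNge.
by rewrite -ltr_pdivrMr // truncnS_gt.
Qed.

End walk_operator.

(** * Functions, and with [T := Prop] sets, that depend on finitely many digits *)

Definition loc_const T n (g : Z2 -> T) :=
  forall a b, residue n a = residue n b -> g a = g b.

Lemma loc_constW T m n (g : Z2 -> T) : (m <= n)%N ->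
  loc_const m g -> loc_const n g.
Proof. by move=> mn gm a b /(residueW mn)/gm. Qed.

(** Translation preserves congruence and doubling improves it by one digit; only halving consumes a
    digit, whence [n.+1]. *)
Lemma loc_const_moves T n (g : Z2 -> T) : loc_const n g ->
  [/\ forall c, loc_const n (fun a => g (a + c)),
      loc_const n (fun a => g (2 * a))
    & loc_const n.+1 (fun a => g (Z2_half a))].
Proof.
move=> gn; split=> [c a b ab|a b ab|a b /eq_residueS[_ ab]]; apply: gn => //.
  exact: eq_residueD.
exact/residueSW/eq_residue_double.
Qed.

Lemma loc_const_even n : loc_const n.+1 Z2_even.
Proof. by move=> a b /eq_residueS[+ _]; rewrite /Z2_even => ->. Qed.

Definition cyl_ind (R : realType) n r (a : Z2) : R := (residue n a == r)%:R.

Lemma loc_const_cyl_ind (R : realType) n r : loc_const n (@cyl_ind R n r).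
Proof. by move=> a b; rewrite /cyl_ind => ->. Qed.

(** Reduces linear statements to cylinder indicators. The constant sequence [r] encodes the natural
    number r, which represents its class modulo 2^n. *)
Lemma loc_const_sum (R : realType) n (g : Z2 -> R) : loc_const n g ->
  g = fun a => \sum_(r < 2 ^ n) g (of_residues (fun=> r)) * cyl_ind R n r a.
Proof.
move=> gn; apply/funext => a.
rewrite (bigD1 (Ordinal (residue_lt n a))) //= /cyl_ind eqxx mulr1.
rewrite big1 ?addr0 => [|r]; last first.
  by rewrite -val_eqE /= eq_sym => /negbTE ->; rewrite mulr0.
by apply: gn; rewrite residue_of_residues // modn_small ?residue_lt.
Qed.

(** * Uniform convergence of the iterates to constants, and the cylinder masses *)

Section ergodic_mean.
Variable R : realType.
Implicit Types (f g : Z2 -> R).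

Lemma loc_const_walk_op n g : loc_const n g -> loc_const n.+1 (walk_op g).
Proof.
move=> /[dup] /(loc_constW (leqnSn n)) gS /loc_const_moves [_ _ gh] a b ab.
have [gD g2 _] := loc_const_moves gS.
have eab := loc_const_even ab.
have [ae|ae] := boolP (Z2_even a).
  rewrite !walk_op_even -?eab // (gD 1 a b) // (gD (- 1) a b) //.
  by rewrite (g2 a b) // (gh a b).
by rewrite !walk_op_odd -?eab // (gD 1 a b) // (gD (- 1) a b) // (g2 a b).
Qed.

Lemma loc_const_walk_iter n g t : loc_const n g ->
  loc_const (n + t) (iter t (@walk_op R) g).
Proof.
elim: t n g => [|t IHt] n g gn; first by rewrite addn0.
by rewrite addnS; apply/loc_const_walk_op/IHt.
Qed.

Lemma walk_iter_itv g (m M : R) t : (forall a, m <= g a <= M) ->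
  forall a, m <= iter t (@walk_op R) g a <= M.
Proof.
move=> gmM; elim: t => // t IHt a.
rewrite -[m](walk_op_cst _ a) -[M](walk_op_cst _ a).
by rewrite /= !walk_op_le // => b; have /andP[] := IHt b.
Qed.

Lemma walk_iter_sum I (s : seq I) (c : I -> R) (F : I -> Z2 -> R) t a :
  iter t (@walk_op R) (fun b => \sum_(i <- s) c i * F i b) a =
  \sum_(i <- s) c i * iter t (@walk_op R) (F i) a.
Proof.
elim: t a => // t IHt a /=; rewrite -walk_op_sum; congr walk_op.
exact/funext.
Qed.

(** At time 0, points agreeing on [n] digits have equal values and any others differ by at most 1,
    which is the indicator of [k < n]. Each application of the operator then costs one step of the
    reflected walk. *)
Lemma walk_iter_modulus n g t : loc_const n g -> (forall a, 0 <= g a <= 1) ->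
  modulus_le (iter t (@walk_op R) g) (reflected_prob R n t).
Proof.
move=> gn g01; elim: t => [k a b ab|t IHt].
  have /andP[_ ?] := g01 a; have /andP[? _] := g01 b.
  rewrite /= /reflected_prob /=.
  case: ltnP => [kn|nk]; last by rewrite (gn a b (residueW nk ab)) subrr.
  rewrite -[X in _ <= X]/1; lra.
by apply: walk_op_modulus IHt => //; exact: reflected_prob_homo.
Qed.

(** All points agree modulo 1, so the modulus at level 0 bounds the whole oscillation of the [t]-th
    iterate, and further averaging stays within its range. *)
Lemma walk_iter_dist n g t s a b : loc_const n g -> (forall a, 0 <= g a <= 1) ->
  `|iter t (@walk_op R) g a - iter (s + t) (@walk_op R) g b|
    <= reflected_prob R n t 0%N.
Proof.
move=> gn g01; rewrite iterD.
set h := iter t _ g; set u := reflected_prob _ _ _ _.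
have hu c d : h c - h d <= u.
  by apply: (walk_iter_modulus t gn g01); rewrite !residue0.
have /(walk_iter_itv s) /(_ b) : forall c, h a - u <= h c <= h a + u.
  by move=> c; have := hu c a; have := hu a c; lra.
by rewrite ler_distlC.
Qed.

(** [walk_iter_cvg] shows that the limit exists, and is the same from every start, when [g] depends
    on finitely many digits and takes values in [0, 1]. *)
Definition ergodic_mean g : R := lim (iter t (@walk_op R) g 0 @[t --> \oo]).

Lemma walk_iter_cvg n g a : loc_const n g -> (forall a, 0 <= g a <= 1) ->
  iter t (@walk_op R) g a @[t --> \oo] --> ergodic_mean g.
Proof.
move=> gn g01; have u0 := @reflected_prob_cvg0 R n.
have c0 : cvgn (fun t => iter t (@walk_op R) g 0).
  (* Every iterate after time [T] is within [reflected_prob R n T 0] of the iterate at [T]. *)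
  apply/cauchy_cvgP/cauchy_exP => e e0.
  have /cvgrPdist_lt/(_ e e0)[T _ uT] := u0.
  exists (iter T (@walk_op R) g 0); exists T => // t /= Tt.
  rewrite /ball /= -(subnK Tt).
  apply: le_lt_trans (walk_iter_dist _ _ _ _ gn g01) _.
  have := uT T (leqnn _); rewrite sub0r normrN ger0_norm //.
  exact: reflected_prob_ge0.
pose v b t := iter t (@walk_op R) g b.
have d0 : (fun t => v a t - v 0 t) @ \oo --> (0 : R).
  apply/norm_cvg0P; apply: (squeeze_cvgr _ (cvg_cst 0) u0).
  by apply: nearW => t; rewrite normr_ge0 (walk_iter_dist t 0 a 0 gn g01).
have -> : (fun t => iter t (@walk_op R) g a) =
    (fun t => (v a t - v 0 t) + v 0 t).
  by apply/funext => t; rewrite subrK.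
by rewrite -[X in _ --> X]add0r; apply: cvgD.
Qed.

(** Let [s] tend to infinity in [walk_iter_dist]; the resulting rate is uniform in [a]. *)
Lemma walk_iter_ergodic_dist n g t a :
  loc_const n g -> (forall a, 0 <= g a <= 1) ->
  `|iter t (@walk_op R) g a - ergodic_mean g| <= reflected_prob R n t 0%N.
Proof.
move=> gn g01.
have gl := walk_iter_cvg 0 gn g01.
have gs : (fun s => iter (s + t) (@walk_op R) g 0) @ \oo --> ergodic_mean g.
  by rewrite (cvg_shiftn t (fun s => iter s (@walk_op R) g 0)).
set x := iter t _ g a.
have gd : (fun s => `|x - iter (s + t) (@walk_op R) g 0|) @ \oo -->
    `|x - ergodic_mean g|.
  by apply: cvg_norm; apply: cvgB => //; exact: cvg_cst.
rewrite -(cvg_lim _ gd) //.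
apply: limr_le; first exact: cvgP gd.
by apply: nearW => s; exact: walk_iter_dist gn g01.
Qed.

(** A shift of time does not change the limit. This becomes stationarity of the measure built from
    the means. *)
Lemma ergodic_mean_walk_op n g : loc_const n g -> (forall a, 0 <= g a <= 1) ->
  ergodic_mean (walk_op g) = ergodic_mean g.
Proof.
move=> gn g01; have gl := walk_iter_cvg 0 gn g01.
rewrite {1}/ergodic_mean; apply: cvg_lim => //.
rewrite -(cvg_shiftS (fun s => iter s (@walk_op R) g 0)) in gl.
by under eq_fun do rewrite -iterSr.
Qed.

Lemma ergodic_mean_ge0 n g : loc_const n g -> (forall a, 0 <= g a <= 1) ->
  0 <= ergodic_mean g.
Proof.
move=> gn g01; apply: limr_ge; first exact: cvgP (walk_iter_cvg 0 gn g01).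
by apply: nearW => t; have /andP[] := walk_iter_itv t g01 0.
Qed.

Lemma ergodic_mean_sum I (s : seq I) (c : I -> R) (F : I -> Z2 -> R)
    (N : I -> nat) :
  (forall i, loc_const (N i) (F i)) -> (forall i a, 0 <= F i a <= 1) ->
  ergodic_mean (fun b => \sum_(i <- s) c i * F i b) =
  \sum_(i <- s) c i * ergodic_mean (F i).
Proof.
move=> FN F01; apply: cvg_lim => //.
under eq_fun do rewrite walk_iter_sum.
apply: cvg_big => [|i _]; first exact: add_continuous.
apply: cvgMr; exact: walk_iter_cvg (FN i) (F01 i).
Qed.

Lemma ergodic_mean_cst (c : R) : ergodic_mean (fun=> c) = c.
Proof.
apply: cvg_lim => //.
rewrite (_ : (fun t => _) = (fun=> c)); first exact: cvg_cst.
apply/funext => t; apply/eqP; rewrite eq_le andbC.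
by apply: (walk_iter_itv t) => a; rewrite lexx.
Qed.

Lemma cyl_ind_itv n r a : 0 <= cyl_ind R n r a <= 1.
Proof. by rewrite /cyl_ind; case: eqP; rewrite ?lexx ?ler01. Qed.

Definition cyl_mass n r : R := ergodic_mean (cyl_ind R n r).

Lemma cyl_mass_ge0 n r : 0 <= cyl_mass n r.
Proof.
exact: ergodic_mean_ge0 (@loc_const_cyl_ind R n r) (cyl_ind_itv n r).
Qed.

Lemma ergodic_mean_loc_const n g : loc_const n g ->
  ergodic_mean g = \sum_(r < 2 ^ n) g (of_residues (fun=> r)) * cyl_mass n r.
Proof.
move=> /loc_const_sum {1}->; rewrite (@ergodic_mean_sum _ _ _ _ (fun=> n)) //.
  by move=> r; exact: loc_const_cyl_ind.
by move=> r a; exact: cyl_ind_itv.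
Qed.

Lemma cyl_mass0 : cyl_mass 0 0 = 1.
Proof.
rewrite -(ergodic_mean_cst 1); congr ergodic_mean; apply/funext => a.
by rewrite /cyl_ind residue0 eqxx.
Qed.

(** A class modulo 2^n splits into two classes modulo 2^(n+1), and the mean is linear; the sum with
    coefficients 1 puts this in the form of [ergodic_mean_sum]. *)
Lemma cyl_massS n r : (r < 2 ^ n)%N ->
  cyl_mass n r = cyl_mass n.+1 r + cyl_mass n.+1 (r + 2 ^ n)%N.
Proof.
move=> rn.
have -> : cyl_mass n.+1 r + cyl_mass n.+1 (r + 2 ^ n)%N =
    \sum_(s <- [:: r; (r + 2 ^ n)%N]) 1 * cyl_mass n.+1 s.
  by rewrite !big_cons big_nil !mul1r addr0.
rewrite -(@ergodic_mean_sum _ _ _ _ (fun=> n.+1)); first last.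
- by move=> s a; exact: cyl_ind_itv.
- by move=> s; exact: loc_const_cyl_ind.
congr ergodic_mean; apply/funext => a.
rewrite !big_cons big_nil !mul1r addr0 /cyl_ind residueS.
have a_lt := residue_lt n a; case: (a n) => /=.
  have -> : (residue n a + 1 * 2 ^ n == r)%N = false by apply/eqP; lia.
  by rewrite mul1n eqn_add2r add0r.
have -> : (residue n a + 0 * 2 ^ n == r + 2 ^ n)%N = false by apply/eqP; lia.
by rewrite mul0n addn0 addr0.
Qed.

End ergodic_mean.

(** * The Borel sigma-algebra, generated by the sets that depend on finitely many digits *)

Definition loc_const_sets : set (set Z2) := [set A | exists n, loc_const n A].

Lemma loc_const_setsI : setI_closed loc_const_sets.
Proof.
move=> A B [m Am] [n Bn]; exists (maxn m n) => a b ab.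
rewrite /setI /mkset (Am a b) ?(Bn a b) //.
  by rewrite (residueW _ ab) // leq_maxr.
by rewrite (residueW _ ab) // leq_maxl.
Qed.

Lemma loc_const_open n (A : set Z2) : loc_const n A -> open A.
Proof.
move=> An; rewrite openE => a Aa; rewrite /interior.
have cyl : \forall b \near a, forall k : 'I_n, (b : Z2) k = a k.
  suff H (k : 'I_n) : \forall b \near a, (b : Z2) k = a k.
    exact: (@filter_forall _ _ _ (nbhs a) _ H).
  have := @proj_continuous nat (fun=> bool) k a.
  by move=> /(_ [set a k]); apply; rewrite /= nbhs_principalE.
apply: filterS cyl => b ba; rewrite (An b a) //.
by apply: eq_digit_residue => k kn; exact: (ba (Ordinal kn)).
Qed.

(** Otherwise each class of [a] modulo 2^n has a point outside [U], and these points converge to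
    [a]. *)
Lemma open_residue (U : set Z2) a : open U -> U a ->
  exists n, forall b, residue n b = residue n a -> U b.
Proof.
rewrite openE => oU Ua; apply: contrapT => /forallNP nU.
have /choice[g gU] n : exists b, residue n b = residue n a /\ ~ U b.
  by have /existsNP[b /not_implyP] := nU n; exists b.
have g_cvg : g @ \oo --> a.
  (* The product topology is the supremum of those induced by single digits, and digit [N] of the
     sequence is constant from index [N.+1] on. *)
  apply/cvg_sup => N U' [V] [[W] oW <-] WfN WU.
  apply: (filterS WU); rewrite nbhs_simpl; exists N.+1 => // i /= Ni.
  by rewrite /= (eq_residue_digit (gU i).1).
have [N _ /(_ N (leqnn N))] := g_cvg _ (oU _ Ua).
exact: (gU N).2.
Qed.

Lemma Z2_measurableE : measurable = <<s loc_const_sets >>.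
Proof.
apply/seteqP; split.
  apply: smallest_sub; first exact: smallest_sigma_algebra.
  move=> U oU.
  (* [F n] is the union of the classes modulo 2^n contained in [U], so an open set is a countable
     union of generators. *)
  pose F n : set Z2 := [set a | forall b, residue n b = residue n a -> U b].
  have -> : U = \bigcup_n F n.
    apply/seteqP; split=> [a /(open_residue oU)[n Un]|a [n _ /(_ a erefl)//]].
    by exists n.
  apply: sigma_algebra_bigcup => n; apply: sub_sigma_algebra.
  by exists n => a b ab; rewrite /F /mkset ab.
apply: smallest_sub; first exact: smallest_sigma_algebra.
by move=> A [n An]; apply: sub_sigma_algebra; exact: loc_const_open An.
Qed.

Lemma measurable_loc_const_set n (A : set Z2) : loc_const n A -> measurable A.
Proof.
by move=> An; rewrite Z2_measurableE; apply: sub_sigma_algebra; exists n.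
Qed.

Lemma measurable_cyl n r : measurable [set a : Z2 | residue n a = r].
Proof.
by apply: (@measurable_loc_const_set n) => a b ab; rewrite /mkset ab.
Qed.

Lemma measurable_loc_const d (T : measurableType d) n (g : Z2 -> T) :
  loc_const n g -> measurable_fun setT g.
Proof.
move=> gn _ A _; rewrite setTI; apply: (@measurable_loc_const_set n) => a b ab.
by rewrite /preimage /mkset (gn a b ab).
Qed.

Lemma measurable_fun_Z2 d (T : measurableType d) (phi : T -> Z2) :
  (forall n (A : set Z2), loc_const n A -> measurable (phi @^-1` A)) ->
  measurable_fun setT phi.
Proof.
move=> mphi; apply: (measurability _ Z2_measurableE).
by move=> _ [A [n An] <-]; rewrite setTI; exact: mphi An.
Qed.

Lemma measurable_moves :
  [/\ forall c, measurable_fun setT (fun a : Z2 => a + c),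
      measurable_fun setT (fun a : Z2 => 2 * a)
    & measurable_fun setT Z2_half].
Proof.
split=> [c||]; apply: measurable_fun_Z2 => n A /loc_const_moves[AD A2 Ah].
- exact: measurable_loc_const_set (AD c).
- exact: measurable_loc_const_set A2.
- exact: measurable_loc_const_set Ah.
Qed.

Lemma measurable_Z2_even : measurable_fun setT Z2_even.
Proof. exact: measurable_loc_const (@loc_const_even 0). Qed.

(** The sets depending on finitely many digits form a generating pi-system that contains the whole
    space. *)
Lemma eq_probability_Z2 (R : realType) (mu nu : probability Z2 R) :
  (forall n A, loc_const n A -> mu A = nu A) ->
  forall A, measurable A -> mu A = nu A.
Proof.
move=> munu; apply: (measure_unique loc_const_sets (fun=> setT)) => //.
- exact: Z2_measurableE.
- exact: loc_const_setsI.
- by move=> _; exists 0%N.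
- by rewrite bigcup_const.
- by move=> A [n An]; exact: munu An.
- by move=> _; rewrite (le_lt_trans (probability_le1 mu measurableT)) ?ltry.
Qed.

(** * A probability measure with prescribed consistent cylinder masses *)

Section measure_of_masses.
Variables (R : realType) (p : nat -> nat -> R).
Hypothesis p_ge0 : forall n r, 0 <= p n r.
Hypothesis p0 : p 0 0 = 1.
Hypothesis pS : forall n r, (r < 2 ^ n)%N ->
  p n r = p n.+1 r + p n.+1 (r + 2 ^ n)%N.

(* [0, 1[ is cut successively into intervals indexed by the residues [r] mod
   2^n, of lengths [p n r]; [mass_left n r] is the left end of the interval of
   [r], and [quantile x] is the point of Z_2 whose intervals all contain [x]. *)
Fixpoint mass_left n r : R :=
  if n is m.+1 then
    if (r < 2 ^ m)%N then mass_left m r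
    else mass_left m (r - 2 ^ m)%N + p m.+1 (r - 2 ^ m)%N
  else 0.

Fixpoint quantile_residue (x : R) n : nat :=
  if n is m.+1 then
    let r := quantile_residue x m in
    (r + (mass_left m r + p m.+1 r <= x)%R * 2 ^ m)%N
  else 0%N.

Definition quantile (x : R) : Z2 := fun n =>
  mass_left n (quantile_residue x n) + p n.+1 (quantile_residue x n) <= x.

Lemma residue_quantile x n : residue n (quantile x) = quantile_residue x n.
Proof. by elim: n => [|n IHn]; rewrite ?residue0 // residueS IHn. Qed.

Lemma quantile_residue_lt x n : (quantile_residue x n < 2 ^ n)%N.
Proof. by rewrite -residue_quantile residue_lt. Qed.

Lemma quantile_residueS x n r : (r < 2 ^ n.+1)%N ->
  (quantile_residue x n.+1 == r) =
  if (r < 2 ^ n)%N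
  then (quantile_residue x n == r) && (x < mass_left n r + p n.+1 r)
  else (quantile_residue x n == r - 2 ^ n)%N &&
       (mass_left n (r - 2 ^ n) + p n.+1 (r - 2 ^ n)%N <= x).
Proof.
rewrite expnS => rn /=; have := quantile_residue_lt x n.
set s := quantile_residue x n => sn; case: ltnP => rn'.
  have [<-|/eqP sr] := eqVneq s r.
    by case: leP => _ /=; apply/eqP; lia.
  by case: leP => _ /=; apply/eqP; lia.
have [sr|/eqP sr] := eqVneq s (r - 2 ^ n)%N.
  by rewrite -sr; case: leP => _ /=; apply/eqP; lia.
by case: leP => _ /=; apply/eqP; lia.
Qed.

(** By [pS] the two subintervals exactly fill their parent, so the digit tests locate [x]; the
    bounds on [x] are what level 0 requires. *)
Lemma quantile_residueE x n r : (r < 2 ^ n)%N -> 0 <= x < 1 ->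
  (quantile_residue x n == r) = (mass_left n r <= x < mass_left n r + p n r).
Proof.
move=> + x01; elim: n r => [|n IHn] r rn.
  by move: rn; rewrite expn0 ltnS leqn0 => /eqP -> /=; rewrite p0 add0r x01.
rewrite quantile_residueS //; case: ltnP => rn' /=.
  rewrite IHn // rn'; have := pS rn'; have := p_ge0 n.+1 (r + 2 ^ n).
  by move=> ? ?; apply/idP/idP; lra.
rewrite ltnNge rn' /=.
have rn2 : (r - 2 ^ n < 2 ^ n)%N by move: rn; rewrite expnS; lia.
rewrite IHn //; have := pS rn2; have := p_ge0 n.+1 (r - 2 ^ n).
by rewrite subnK // => ? ?; apply/idP/idP; lra.
Qed.

(** Measurability is wanted on the whole line, beyond the reach of [quantile_residueE], so each
    digit test contributes a half-line instead. *)
Lemma measurable_quantile_residue n r :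
  measurable [set x : measurableTypeR R | quantile_residue x n = r].
Proof.
case: (ltnP r (2 ^ n)) => [|nr]; last first.
  rewrite (_ : mkset _ = set0) //; apply/seteqP; split=> // x /= xr.
  by have := quantile_residue_lt x n; rewrite xr ltnNge nr.
elim: n r => [|n IHn] r rn.
  move: rn; rewrite expn0 ltnS leqn0 => /eqP ->.
  by rewrite (_ : mkset _ = setT) //; apply/seteqP.
have [rn'|rn'] := ltnP r (2 ^ n).
  rewrite (_ : mkset _ = [set x | quantile_residue x n = r] `&`
      `]-oo, mass_left n r + p n.+1 r[); first exact: measurableI (IHn _ rn') _.
  apply/seteqP; split=> x; rewrite /mkset /setI /mkset in_itv /=.
    by move/eqP; rewrite quantile_residueS // rn' => /andP[/eqP].
  by move=> [/eqP xr xl]; apply/eqP; rewrite quantile_residueS // rn' xr.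
have rn2 : (r - 2 ^ n < 2 ^ n)%N by move: rn; rewrite expnS; lia.
rewrite (_ : mkset _ = [set x | quantile_residue x n = r - 2 ^ n]%N `&`
    `[mass_left n (r - 2 ^ n) + p n.+1 (r - 2 ^ n)%N, +oo[);
  first exact: measurableI (IHn _ rn2) _.
apply/seteqP; split=> x; rewrite /mkset /setI /mkset in_itv /= andbT.
  by move/eqP; rewrite quantile_residueS // ltnNge rn' => /andP[/eqP].
by move=> [/eqP xr xl]; apply/eqP; rewrite quantile_residueS // ltnNge rn' xr.
Qed.

Lemma measurable_quantile :
  measurable_fun setT (quantile : measurableTypeR R -> Z2).
Proof.
apply: measurable_fun_Z2 => n A An.
rewrite (_ : _ @^-1` A = \bigcup_(r in [set r | A (of_residues (fun=> r))])
  [set x | quantile_residue x n = r]).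
  by apply: bigcup_measurable => r _; exact: measurable_quantile_residue.
have resK x : residue n (of_residues (fun=> quantile_residue x n)) =
    residue n (quantile x).
  rewrite residue_of_residues // residue_quantile modn_small //.
  exact: quantile_residue_lt.
apply/seteqP; split=> [x Ax|x [r /= Ar xr]].
  by exists (quantile_residue x n) => //=; rewrite (An _ _ (resK x)).
by rewrite /preimage /mkset -(An _ _ (resK x)) xr.
Qed.

Lemma mass_left_ge0 n r : (r < 2 ^ n)%N -> 0 <= mass_left n r.
Proof.
elim: n r => //= n IHn r rn; case: ltnP => rn'; first exact: IHn.
by rewrite addr_ge0 ?IHn //; move: rn; rewrite expnS; lia.
Qed.

Lemma mass_left_le1 n r : (r < 2 ^ n)%N -> mass_left n r + p n r <= 1.
Proof.
elim: n r => [|n IHn] r rn /=.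
  by move: rn; rewrite expn0 ltnS leqn0 => /eqP ->; rewrite p0 add0r.
case: ltnP => rn'.
  have := IHn _ rn'; have := pS rn'; have := p_ge0 n.+1 (r + 2 ^ n); lra.
have rn2 : (r - 2 ^ n < 2 ^ n)%N by move: rn; rewrite expnS; lia.
by have := IHn _ rn2; have := pS rn2; rewrite subnK //; lra.
Qed.

Local Open Scope ereal_scope.

(** Take the law of [quantile] under Lebesgue measure on [0, 1[: the preimage of a cylinder is its
    interval. *)
Lemma measure_of_masses : exists nu : probability Z2 R,
  forall n r, (r < 2 ^ n)%N -> nu [set a | residue n a = r] = (p n r)%:E.
Proof.
have mD : measurable (`[0%R, 1%R[ : set (measurableTypeR R)).
  exact: measurable_itv.
pose U := mrestr (@lebesgue_measure R) mD.
have U1 : U setT = 1.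
  by rewrite /U /mrestr setTI lebesgue_measure_itv /= lte_fin ltr01 sube0.
pose mq := isMeasurableFun.Build _ _ _ _ (quantile : measurableTypeR R -> Z2)
  measurable_quantile.
pose P : probability (measurableTypeR R) R :=
  HB.pack U (Measure_isProbability.Build _ _ _ U U1).
pose q : {mfun measurableTypeR R >-> Z2} := HB.pack quantile mq.
exists (distribution P q) => n r rn.
rewrite /distribution /pushforward /= /U /mrestr.
rewrite (_ : _ `&` _ = `[mass_left n r, (mass_left n r + p n r)%R[%classic).
  rewrite lebesgue_measure_itv /= lte_fin ltrDl lt_neqAle p_ge0 andbT.
  case: eqP => /= [<-//|_]; by rewrite -EFinB addrAC subrr add0r.
have := mass_left_ge0 rn; have := mass_left_le1 rn => h1 h0.
apply/seteqP; split=> x; rewrite /= !in_itv /=.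
  by rewrite residue_quantile => -[/eqP + x01]; rewrite quantile_residueE.
move=> /andP[lx xl].
have x01 : (0 <= x < 1)%R by lra.
rewrite x01 residue_quantile; split=> //.
by apply/eqP; rewrite quantile_residueE // lx.
Qed.

End measure_of_masses.

(** * Stationary measures: values on finitely determined sets, and existence *)

Section stationarity.
Variable R : realType.
Implicit Types (f g : Z2 -> R) (mu nu : probability Z2 R).

Lemma walk_stepE (A : set Z2) a : walk_step R a A = (walk_op (\1_A) a)%:E.
Proof.
by rewrite /walk_step /walk_op EFinM -sumEFin.
Qed.

Lemma loc_const_indic n (A : set Z2) : loc_const n A ->
  loc_const n (\1_A : Z2 -> R).
Proof.
move=> An a b ab; rewrite !indicE (_ : (a \in A) = (b \in A)) //.
by apply/idP/idP; rewrite !in_setE (An a b ab).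
Qed.

Lemma indic_itv (A : set Z2) a : 0 <= (\1_A a : R) <= 1.
Proof. by rewrite indicE; case: (a \in A); rewrite ?lexx ?ler01. Qed.

Lemma measurable_walk_op g : measurable_fun setT g ->
  measurable_fun setT (walk_op g).
Proof.
move=> mg; have [mD m2 mh] := measurable_moves.
have mgD c : measurable_fun setT (fun a : Z2 => g (a + c)).
  exact: measurableT_comp mg (mD c).
have mg2 : measurable_fun setT (fun a : Z2 => g (2 * a)).
  exact: measurableT_comp mg m2.
have mgh : measurable_fun setT (fun a : Z2 => g (Z2_half a)).
  exact: measurableT_comp mg mh.
have -> : walk_op g = fun a => if Z2_even a
    then 4^-1 * (g (a + 1) + g (a - 1) + g (2 * a) + g (Z2_half a))
    else 3^-1 * (g (a + 1) + g (a - 1) + g (2 * a)).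
  apply/funext => a; have [ae|ae] := boolP (Z2_even a).
    by rewrite walk_op_even.
  by rewrite walk_op_odd.
apply: measurable_fun_ifT; first exact: measurable_Z2_even.
  by apply: measurable_funM => //; do ?apply: measurable_funD => //.
by apply: measurable_funM => //; do ?apply: measurable_funD => //.
Qed.

Local Open Scope ereal_scope.

Lemma measurable_walk_step (A : set Z2) : measurable A ->
  measurable_fun setT (walk_step R ^~ A).
Proof.
move=> mA; under eq_fun do rewrite walk_stepE.
apply/measurable_EFinP; apply: measurable_walk_op.
exact: measurable_indic.
Qed.

Lemma walk_step_ge0 a (A : set Z2) : 0 <= walk_step R a A.
Proof.
rewrite walk_stepE lee_fin -(walk_op_cst 0%R a).
by rewrite walk_op_le // => b; rewrite indicE.
Qed.

Lemma integral_loc_const_sum nu n (c : nat -> R) (F : nat -> Z2 -> R) :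
  (forall r, 0 <= c r)%R -> (forall r a, 0 <= F r a)%R ->
  (forall r, measurable_fun setT (F r)) ->
  \int[nu]_a (\sum_(r < n) c r * F r a)%R%:E =
  \sum_(r < n) (c r)%:E * \int[nu]_a (F r a)%:E.
Proof.
move=> c0 F0 mF; under eq_integral do rewrite -sumEFin.
rewrite ge0_integral_sum //.
- apply: eq_bigr => r _; under eq_integral do rewrite EFinM.
  rewrite ge0_integralZl_EFin // ?(measurable_EFinP _ _).2 //.
    by move=> a _; rewrite lee_fin.
  exact/measurable_EFinP.
- by move=> r; apply/measurable_EFinP/measurable_funM.
- by move=> r a _; rewrite lee_fin mulr_ge0.
Qed.

Lemma cyl_indE n r : cyl_ind R n r = \1_[set a | residue n a = r].
Proof.
apply/funext => a; rewrite /cyl_ind indicE; congr (nat_of_bool _)%:R.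
by apply/eqP/idP => [|/set_mem//]; exact: mem_set.
Qed.

Lemma integral_cyl_ind nu n r :
  \int[nu]_a (cyl_ind R n r a)%:E = nu [set a | residue n a = r].
Proof.
by rewrite cyl_indE integral_indic ?setIT //; exact: measurable_cyl.
Qed.

(** Stationarity is this identity for indicators; expansion in cylinder indicators extends it by
    linearity. *)
Lemma integral_walk_op mu n g : walk_stationary mu -> loc_const n g ->
  (forall a, 0 <= g a)%R ->
  \int[mu]_a (walk_op g a)%:E = \int[mu]_a (g a)%:E.
Proof.
move=> mu_stat gn g0; pose c r := g (of_residues (fun=> r)).
have mcyl r : measurable_fun setT (cyl_ind R n r).
  exact: measurable_loc_const (@loc_const_cyl_ind R n r).
have cyl0 r a : (0 <= cyl_ind R n r a)%R by rewrite ler0n.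
have c0 r : (0 <= c r)%R by exact: g0.
have -> : walk_op g =
    fun a => (\sum_(r < 2 ^ n) c r * walk_op (cyl_ind R n r) a)%R.
  by apply/funext => a; rewrite {1}(loc_const_sum gn) walk_op_sum.
have -> : \int[mu]_a (g a)%:E =
    \int[mu]_a (\sum_(r < 2 ^ n) c r * cyl_ind R n r a)%R%:E.
  by rewrite {1}(loc_const_sum gn).
rewrite (@integral_loc_const_sum mu _ c (cyl_ind R n)) //.
rewrite (@integral_loc_const_sum mu _ c (fun r => walk_op (cyl_ind R n r))) //;
  first last.
- by move=> r; exact: measurable_walk_op.
- by move=> r a; rewrite -[leLHS](walk_op_cst 0%R a) walk_op_le.
apply: eq_bigr => r _; congr (_ * _).
rewrite integral_cyl_ind -mu_stat; last exact: measurable_cyl.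
by apply: eq_integral => a _; rewrite walk_stepE cyl_indE.
Qed.

(** The integral of the [t]-th iterate of the indicator is [mu A] for every [t], while the iterates
    converge uniformly to the ergodic mean. *)
Lemma stationary_loc_const mu n (A : set Z2) : walk_stationary mu ->
  loc_const n A -> mu A = (ergodic_mean (\1_A : Z2 -> R))%:E.
Proof.
move=> mu_stat An; have mA := measurable_loc_const_set An.
set g : Z2 -> R := \1_A; set e := ergodic_mean g.
have gn : loc_const n g by exact: loc_const_indic.
have g01 a : (0 <= g a <= 1)%R by exact: indic_itv.
pose h t := iter t (@walk_op R) g.
have h0 t a : (0 <= h t a)%R by have /andP[] := walk_iter_itv t g01 a.
have mh t : measurable_fun setT (h t).
  apply: (@measurable_loc_const _ _ (n + t)); exact: loc_const_walk_iter.
have muA t : mu A = \int[mu]_a (h t a)%:E.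
  elim: t => [|t ->]; first by rewrite integral_indic // setIT.
  have ht := @loc_const_walk_iter R n g t gn.
  by rewrite /= (integral_walk_op mu_stat ht) //; exact: h0.
have int_cst (x : R) : \int[mu]_a x%:E = x%:E.
  by rewrite integral_cst // [X in _ * X](@probability_setT _ _ _ mu) mule1.
have muAfin : mu A \is a fin_num by exact: fin_num_measure.
rewrite -(fineK muAfin); congr EFin; set m := fine (mu A).
have mt t : \int[mu]_a (h t a)%:E = m%:E by rewrite -muA fineK.
have u_ge0 t : (0 <= reflected_prob R n t 0)%R by exact: reflected_prob_ge0.
have e0 : (0 <= e)%R by exact: ergodic_mean_ge0 gn g01.
have he t a := walk_iter_ergodic_dist t a gn g01.
have mhE t : measurable_fun setT (fun a => (h t a)%:E).
  exact/measurable_EFinP.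
have hi t : (m <= e + reflected_prob R n t 0)%R.
  rewrite -lee_fin -(mt t) -[leRHS]int_cst; apply: ge0_le_integral => //.
  - by move=> a _; rewrite lee_fin.
  - move=> a _; rewrite lee_fin; have := he t a.
    by rewrite ler_norml -/(h t a) -/e; lra.
(* The error is added on the right so that all integrands remain nonnegative. *)
have lo t : (e <= m + reflected_prob R n t 0)%R.
  rewrite -lee_fin EFinD -(mt t) -[leLHS]int_cst -[X in _ + X]int_cst.
  rewrite -ge0_integralD //; [|by move=> a _; rewrite lee_fin..].
  apply: ge0_le_integral => //; first exact: emeasurable_funD.
  move=> a _; rewrite -EFinD lee_fin; have := he t a.
  by rewrite ler_norml -/(h t a) -/e; lra.
have me t : (`|m - e| <= reflected_prob R n t 0)%R.
  by rewrite ler_norml; have := hi t; have := lo t; lra.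
apply/eqP; rewrite -subr_eq0 -normr_le0.
have u0 := @reflected_prob_cvg0 R n.
rewrite -(cvg_lim _ u0) //; apply: limr_ge; first exact: cvgP u0.
exact: nearW.
Qed.

(** For fixed [a] the step is a multiple of a finite sum of Dirac measures, and nonnegativity lets
    series and integral be exchanged. *)
Lemma walk_step_sigma_additive nu :
  semi_sigma_additive (fun A => \int[nu]_a walk_step R a A).
Proof.
move=> F mF tF mUF.
have c0 a : (0 <= (size (walk_moves a))%:R^-1 :> R)%R by rewrite invr_ge0.
pose k a : {measure set Z2 -> \bar R} :=
  mscale (NngNum (c0 a))
    (msum (fun i => \d_(nth 0%R (walk_moves a) i)) (size (walk_moves a))).
have kE a A : walk_step R a A = k a A.
  by rewrite /walk_step /k /mscale /= /msum (big_nth 0%R) big_mkord.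
have -> : \int[nu]_a walk_step R a (\bigcup_n F n) =
    \sum_(n <oo) \int[nu]_a walk_step R a (F n).
  rewrite -integral_nneseries //.
  - apply: eq_integral => a _; rewrite kE measure_semi_bigcup //.
    by apply: eq_eseriesr => n _; rewrite kE.
  - by move=> n; exact: measurable_walk_step.
  - by move=> n a _; exact: walk_step_ge0.
apply: is_cvg_nneseries => n _ _; apply: integral_ge0 => a _.
exact: walk_step_ge0.
Qed.

(** The law after one step from [nu] is itself a probability measure, so agreement with [nu] on the
    pi-system suffices. *)
Lemma stationary_of_loc_const nu :
  (forall n (A : set Z2), loc_const n A -> \int[nu]_a walk_step R a A = nu A) ->
  walk_stationary nu.
Proof.
move=> nuA A mA; pose m A := \int[nu]_a walk_step R a A.
have m0 : m set0 = 0.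
  apply: integral0_eq => a _; rewrite walk_stepE.
  rewrite (_ : \1_set0 = fun=> 0%R) ?walk_op_cst //.
  by apply/funext => b; rewrite indic0.
have mge0 B : 0 <= m B by apply: integral_ge0 => a _; exact: walk_step_ge0.
pose mm := isMeasure.Build _ _ _ m m0 mge0 (@walk_step_sigma_additive nu).
have mT : m setT = 1 by rewrite /m (nuA 0%N) // probability_setT.
pose M : {measure set Z2 -> \bar R} := HB.pack m mm.
pose mp := Measure_isProbability.Build _ _ _ M mT.
pose P : probability Z2 R := HB.pack m mm mp.
by apply: (@eq_probability_Z2 R P nu) => // n B Bn; exact: nuA Bn.
Qed.

Lemma exists_stationary : exists nu : probability Z2 R, walk_stationary nu.
Proof.
have [nu nuE] :=
  measure_of_masses (@cyl_mass_ge0 R) (cyl_mass0 R) (@cyl_massS R).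
exists nu; apply: stationary_of_loc_const => n A An.
(* Both sides are linear and agree on cylinder indicators by the choice of [nu]. *)
have int_nu m g : loc_const m g -> (forall a, 0 <= g a)%R ->
    \int[nu]_a (g a)%:E = (ergodic_mean g)%:E.
  move=> gm g0; pose c r := g (of_residues (fun=> r)).
  have -> : \int[nu]_a (g a)%:E =
      \int[nu]_a (\sum_(r < 2 ^ m) c r * cyl_ind R m r a)%R%:E.
    by rewrite {1}(loc_const_sum gm).
  rewrite (@integral_loc_const_sum nu _ c (cyl_ind R m)) // => [|r|r].
  - rewrite (ergodic_mean_loc_const gm) -sumEFin; apply: eq_bigr => r _.
    by rewrite EFinM integral_cyl_ind nuE.
  - exact: g0.
  - exact: measurable_loc_const (@loc_const_cyl_ind R m r).
have mA := measurable_loc_const_set An.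
have g01 a : (0 <= (\1_A a : R) <= 1)%R by exact: indic_itv.
have gn := loc_const_indic An.
under eq_integral do rewrite walk_stepE.
rewrite (int_nu _ _ (loc_const_walk_op gn)); last first.
  by move=> a; rewrite -[leLHS](walk_op_cst 0%R a) walk_op_le.
rewrite (ergodic_mean_walk_op gn g01) -(int_nu _ _ gn); last first.
  by move=> a; have /andP[] := g01 a.
by rewrite integral_indic // setIT.
Qed.

End stationarity.

(** * Absence of atoms *)

Lemma residue_nat n k : residue n (k%:R : Z2) = (k %% 2 ^ n)%N.
Proof.
elim: k => [|k IHk]; first by rewrite [LHS]residue_zero mod0n.
by rewrite -addn1 natrD [LHS]residue_add IHk [residue n 1]residue_one modnDm.
Qed.

Lemma Z2_natr_inj : injective (fun k => k%:R : Z2).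
Proof.
move=> j k jk; set n := maxn j k.
have := congr1 (residue n.+1) jk; rewrite !residue_nat !modn_small //.
  by rewrite (leq_ltn_trans (leq_maxr j k)) // ltnW // ltn_expl.
by rewrite (leq_ltn_trans (leq_maxl j k)) // ltnW // ltn_expl.
Qed.

Lemma Z2_double_eq (a b : Z2) : (2 * a == b) = Z2_even b && (Z2_half b == a).
Proof.
apply/eqP/andP => [<-|[be /eqP <-]]; last exact: Z2_halfK.
by rewrite Z2_double_even Z2_doubleK.
Qed.

(** Edges are undirected, so multiplicities are symmetric and the walk is reversible with respect to
    the degree. *)
Lemma count_walk_moves (a b : Z2) :
  count_mem a (walk_moves b) = count_mem b (walk_moves a).
Proof.
(* A halving from [d] to [c] is counted as [2 * c == d], the mirror image of a doubling. *)
have movesE c d : count_mem c (walk_moves d) =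
   ((d + 1 == c)%R + (d - 1 == c)%R + (2 * d == c)%R + (2 * c == d)%R)%N.
  rewrite walk_movesE [2 * c == d]Z2_double_eq.
  by case: ifP => _ /=; rewrite !addn0 ?addnA.
rewrite !movesE [a + 1 == b]eq_sym [a - 1 == b]eq_sym -!subr_eq opprK.
by rewrite [RHS]addnAC [in RHS](addnC (b - 1 == a)%R).
Qed.

Lemma size_walk_moves_gt0 (a : Z2) : (0 < size (walk_moves a))%N.
Proof. by rewrite walk_movesE; case: ifP. Qed.

Lemma measurable_Z2_set1 (a : Z2) : measurable [set a].
Proof.
rewrite (_ : [set a] = \bigcap_n [set b | residue n b = residue n a]).
  by apply: bigcapT_measurable => n; exact: measurable_cyl.
apply/seteqP; split=> [b -> //|b ba]; apply: residue_inj => n; exact: ba.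
Qed.

Section no_atom.
Variables (R : realType) (nu : probability Z2 R).
Hypothesis nu_stat : walk_stationary nu.

Definition atom_density a : R := fine (nu [set a]) / (size (walk_moves a))%:R.

Let h := atom_density.

Lemma atom_density_ge0 a : 0 <= h a.
Proof. by rewrite divr_ge0 // fine_ge0. Qed.

Lemma atom_density_mulr a : (size (walk_moves a))%:R * h a = fine (nu [set a]).
Proof.
by rewrite mulrC divfK // pnatr_eq0 -lt0n size_walk_moves_gt0.
Qed.

Lemma atom_density_le1 a : h a <= 1.
Proof.
have : fine (nu [set a]) <= 1.
  rewrite -lee_fin fineK ?fin_num_measure //; last exact: measurable_Z2_set1.
  by apply: probability_le1; exact: measurable_Z2_set1.
rewrite -atom_density_mulr; apply: le_trans.
by rewrite ler_peMl ?atom_density_ge0 // ler1n size_walk_moves_gt0.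
Qed.

(** Stationarity at the singleton sums [nu] of each predecessor over its degree; by symmetry of
    multiplicities the predecessors are the neighbours. *)
Lemma atom_density_harmonic a :
  (size (walk_moves a))%:R * h a = \sum_(b <- walk_moves a) h b.
Proof.
rewrite atom_density_mulr; apply: EFin_inj.
rewrite fineK; last by apply: fin_num_measure; exact: measurable_Z2_set1.
rewrite -nu_stat; last exact: measurable_Z2_set1.
have step x : walk_step R x [set a] = (\sum_(b <- walk_moves a)
    ((size (walk_moves b))%:R^-1)%:E * (\1_[set b] x)%:E)%E.
  rewrite walk_stepE /walk_op.
  have -> : \sum_(b <- walk_moves x) (\1_[set a] b : R) =
      \sum_(b <- walk_moves a) \1_[set b] x.
    have cnt (c d : Z2) :
        \sum_(b <- walk_moves d) ((b == c) : nat)%:R =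
        (count_mem c (walk_moves d))%:R :> R.
      by rewrite -natr_sum -sum1_count [in RHS]big_mkcond.
    transitivity ((count_mem a (walk_moves x))%:R : R).
      by rewrite -cnt; apply: eq_bigr => b _; rewrite indicE.
    rewrite count_walk_moves -cnt; apply: eq_bigr => b _.
    by rewrite indicE eq_sym.
  rewrite mulr_sumr -sumEFin; apply: eq_bigr => b _; rewrite -EFinM; congr EFin.
  rewrite indicE; have [/set_mem ->//|_] := boolP (x \in [set b]).
  by rewrite !mulr0.
have mb b : measurable_fun setT (fun x : Z2 => (\1_[set b] x : R)%:E).
  apply/measurable_EFinP; apply: measurable_indic; exact: measurable_Z2_set1.
under eq_integral do rewrite step.
rewrite ge0_integral_sum //.
- rewrite -sumEFin; apply: eq_bigr => b _; rewrite ge0_integralZl_EFin //.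
    rewrite integral_indic ?setIT //; last exact: measurable_Z2_set1.
    rewrite /h /atom_density EFinM fineK; first by rewrite muleC.
    by apply: fin_num_measure; exact: measurable_Z2_set1.
- by move=> b; apply: measurable_funeM.
Qed.

(** The deficit [M - h a] is the average of at most four nonnegative deficits, so none of them
    exceeds [4 * d]. *)
Lemma atom_density_succ M a (d : R) : (forall b, h b <= M) -> M - d <= h a ->
  M - 4 * d <= h (a + 1).
Proof.
move=> hM ad; have d0 : 0 <= d by have := hM a; lra.
have := atom_density_harmonic a; rewrite walk_movesE.
have := hM (a - 1); have := hM (2 * a); have := hM (Z2_half a).
case: ifP => _; rewrite !big_cons big_nil /= addr0; lra.
Qed.

Lemma stationary_no_atom a : nu [set a] = 0%E.
Proof.
have nu_fin b : nu [set b] \is a fin_num.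
  by apply: fin_num_measure; exact: measurable_Z2_set1.
rewrite -(fineK (nu_fin a)) -atom_density_mulr.
suff -> : h a = 0 by rewrite mulr0.
apply/le_anti; rewrite atom_density_ge0 andbT leNgt; apply/negP => ha.
have h_sup : has_sup (range h).
  by split; [exists (h a), a|exists 1 => _ [b _ <-]; exact: atom_density_le1].
set M := sup (range h).
have hM b : h b <= M by apply: ub_le_sup; [exact: h_sup.2|exists b].
have M0 : 0 < M by apply: lt_le_trans (hM a).
(* [K] atoms of mass at least [M / 2] have total mass above 1. The tolerance at [b] below absorbs a
   factor 4 for each of [K] shifts and still leaves a deficit of at most [M / 2]. *)
pose K := (Num.Def.truncn (2 / M)).+1.
have [|_ [b _ <-] hb] := @sup_adherent _ (range h) (M / 2 / 4 ^+ K) _ h_sup.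
  by rewrite !divr_gt0 // exprn_gt0.
have hbk k : M - 4 ^+ k * (M / 2 / 4 ^+ K) <= h (b + k%:R).
  elim: k => [|k IHk]; first by rewrite expr0 mul1r addr0 ltW.
  have -> : b + k.+1%:R = b + k%:R + 1 by rewrite -natr1 addrA.
  by rewrite exprS -mulrA atom_density_succ.
have hbK k : (k < K)%N -> M / 2 <= fine (nu [set b + k%:R]).
  move=> kK; rewrite -atom_density_mulr.
  have : 4 ^+ k * (M / 2 / 4 ^+ K) <= M / 2.
    rewrite mulrCA -[leRHS]mulr1 ler_wpM2l //; first by lra.
    by rewrite ler_pdivrMr ?exprn_gt0 // mul1r ler_weXn2l ?ler1n // ltnW.
  set c := b + k%:R.
  have := hbk k; rewrite -/c; have : h c <= (size (walk_moves c))%:R * h c.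
    by rewrite ler_peMl ?atom_density_ge0 // ler1n size_walk_moves_gt0.
  lra.
pose A (k : nat) : set Z2 := [set b + k%:R].
have tA : trivIset setT A.
  apply/trivIsetP => i j _ _ ij.
  apply/seteqP; split=> // c [/= -> /addrI/Z2_natr_inj].
  by move/eqP; rewrite (negbTE ij).
have : (\sum_(k < K) nu (A k) <= 1)%E.
  rewrite -measure_bigsetU //; last by move=> k; exact: measurable_Z2_set1.
  apply: probability_le1.
  by apply: bigsetU_measurable => k _; exact: measurable_Z2_set1.
apply/negP; rewrite -ltNge.
apply: (@lt_le_trans _ _ (\sum_(k < K) (M / 2)%:E)%E).
  rewrite sumEFin lte_fin sumr_const card_ord.
  rewrite -(mulr_natl _ K) -ltr_pdivrMr ?divr_gt0 //.
  by rewrite mul1r invf_div truncnS_gt.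
by apply: lee_sum => k _; rewrite -(fineK (nu_fin _)) lee_fin hbK.
Qed.

End no_atom.

Local Open Scope ereal_scope.

Theorem theorem3p10 (R : realType) :
  exists nu : probability Z2 R,
    [/\ walk_stationary nu,
        forall mu : probability Z2 R, walk_stationary mu ->
          forall A : set Z2, measurable A -> mu A = nu A
      & forall a : Z2, nu [set a] = 0].
Proof.
have [nu nu_stat] := exists_stationary R; exists nu; split=> // [mu mu_stat|a].
  apply: eq_probability_Z2 => n A An.
  rewrite (stationary_loc_const mu_stat An).
  by rewrite (stationary_loc_const nu_stat An).
exact: stationary_no_atom.
Qed.
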